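(* For every real $n>0$ (and $a>0$), the series $$\frac{8a}{n}\sum_{m=0}^{\infty}\frac{1}{u_m}\binom{1/2}{m}\,{}_2F_1\!\left(1+\frac1n,\,u_m;\,u_m+1;\,-1\right)$$ converges absolutely, where $$u_m=\begin{cases}1+\dfrac{2m(1-n)}{n}, & 0<n\le 1,\\[8pt] \dfrac{1+2m(n-1)}{n}, & n\ge 1.\end{cases}$$
   Context: $\binom{1/2}{m}=\frac{(1/2)(1/2-1)\cdots(1/2-m+1)}{m!}$ is the generalized binomial coefficient (equal to $1$ for $m=0$). ${}_2F_1(v,u;w;\gamma)$ is the Gauss hypergeometric function (analytically continued to $\mathbb{C}\setminus[1,\infty)$), given for $w>u>0$ and real $\gamma<1$ by Euler's integral ${}_2F_1(v,u;w;\gamma)=\frac{\Gamma(w)}{\Gamma(u)\Gamma(w-u)}\int_0^1\xi^{u-1}(1-\xi)^{w-u-1}(1-\gamma\xi)^{-v}\,d\xi$. *)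

(* Defs.v *)
From HB Require Import structures.
From mathcomp Require Import all_boot all_order all_algebra.
From mathcomp Require Import all_classical all_reals all_analysis.
Set Implicit Arguments.
Unset Strict Implicit.
Unset Printing Implicit Defensive.
Import Order.TTheory GRing.Theory Num.Theory.
Import numFieldNormedType.Exports.
Local Open Scope classical_set_scope.
Local Open Scope ring_scope.

Definition gbinom (R : realType) (x : R) (m : nat) : R :=
  (\prod_(i < m) (x - i%:R)) / m`!%:R.

Definition Gamma (R : realType) (s : R) : R :=
  \int[lebesgue_measure]_(t in `]0%R, +oo[) (t `^ (s - 1) * expR (- t)).

(* Euler's integral: the value of the analytic continuation of 2F1 to
   C \ [1, +oo) at a real c < 1, for real parameters w > u > 0. Outside this
   range the total function below carries no meaning. *)
Definition hyp2F1 (R : realType) (v u w c : R) : R :=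
  Gamma w / (Gamma u * Gamma (w - u)) *
  \int[lebesgue_measure]_(xi in `]0%R, 1%R[)
     (xi `^ (u - 1) * (1 - xi) `^ (w - u - 1) * (1 - c * xi) `^ (- v)).

Definition u_ (R : realType) (n : R) (m : nat) : R :=
  if n <= 1 then 1 + 2 * m%:R * (1 - n) / n
  else (1 + 2 * m%:R * (n - 1)) / n.

(* The two branches agree at n = 1. *)
Lemma u_ge1 (R : realType) (n : R) (m : nat) :
  1 <= n -> u_ n m = (1 + 2 * m%:R * (n - 1)) / n.
Proof.
rewrite /u_ => n1; case: ifP => // nle1.
have -> : n = 1 by apply/eqP; rewrite eq_le nle1 n1.
by rewrite subrr !mulr0 mul0r addr0 divr1.
Qed.

(* All the hypergeometric values of the series lie in the range w > u > 0 of
   Euler's integral. *)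
Lemma u_gt0 (R : realType) (n : R) (m : nat) : 0 < n -> 0 < u_ n m.
Proof.
move=> n0; rewrite /u_; case: ifP => [n1|/negbT]; last rewrite -ltNge => n1.
  rewrite ltr_pwDl// divr_ge0 ?(ltW n0)// mulr_ge0 ?subr_ge0// mulr_ge0//.
rewrite divr_gt0// ltr_pwDl// mulr_ge0 ?subr_ge0 ?(ltW n1)// mulr_ge0//.
Qed.

Definition series_term (R : realType) (a n : R) (m : nat) : R :=
  8 * a / n *
  ((u_ n m)^-1 * gbinom (1 / 2) m *
   hyp2F1 (1 + 1 / n) (u_ n m) (u_ n m + 1) (- 1)).

(* Main.v *)
(** The term of index [m] is [O(|binom(1/2, m)|)]: for [m >= 1] one has
    [u_m >= 1], so Euler's integral is at most [1], while the Gamma prefactor is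
    at most [u_m / Gamma 1], which cancels [1 / u_m]. With
    [b_m = |binom(1/2, m)|] the recurrence [(m + 1) b_(m+1) = (m - 1/2) b_m]
    for [m >= 1] gives [b_m = 2 (m b_m - (m + 1) b_(m+1))], so [sum b_m]
    telescopes to a bounded quantity. *)
Require Import Defs.
From HB Require Import structures.
From mathcomp Require Import all_boot all_order all_algebra.
From mathcomp Require Import all_classical all_reals all_analysis.
From mathcomp Require Import measurable_realfun ring lra.
Set Implicit Arguments.
Unset Strict Implicit.
Unset Printing Implicit Defensive.
Import Order.TTheory GRing.Theory Num.Theory.
Import numFieldNormedType.Exports.
Local Open Scope classical_set_scope.
Local Open Scope ring_scope.

Lemma gbinomS (R : realType) (x : R) (m : nat) :
  gbinom x m.+1 = gbinom x m * ((x - m%:R) / m.+1%:R).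
Proof.
by rewrite /gbinom big_ord_recr /= mulf_div factS natrM [_`!%:R * _]mulrC.
Qed.

Lemma telescope_normr_gbinom_half (R : realType) (m : nat) : (0 < m)%N ->
  `|gbinom (1 / 2 : R) m| =
    2 * (m%:R * `|gbinom (1 / 2) m| - m.+1%:R * `|gbinom (1 / 2) m.+1|).
Proof.
move=> m0; rewrite gbinomS; move: (gbinom _ m) => b; rewrite normrM normf_div.
have m1 : 1 <= m%:R :> R by rewrite ler1n.
rewrite (ger0_norm (ler0n _ m.+1)) (ler0_norm (_ : 1 / 2 - m%:R <= 0)); last lra.
rewrite -natr1; field; lra.
Qed.

Lemma cvg_series_normr_gbinom_half (R : realType) :
  cvgn (series (fun m => `|gbinom (1 / 2 : R) m|)).
Proof.
set b : nat -> R := fun m => _; have b0 m : 0 <= b m by exact: normr_ge0.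
(* The telescoping identity holds only from index 1 on, so [b 0] and the boundary value [2 * b 1]
   remain on the right. The second summand on the left is nonnegative; dropping it bounds the
   partial sums. *)
suff bnd n : series b n.+1 + 2 * (n.+1%:R * b n.+1) = b 0%N + 2 * b 1%N.
  apply: nondecreasing_is_cvgn; first exact: nondecreasing_series.
  exists (b 0%N + 2 * b 1%N) => _ [n _ <-].
  apply: (@le_trans _ _ (series b n.+1)).
    by apply: nondecreasing_series => //; exact: leqnSn.
  by rewrite -(bnd n) lerDl !mulr_ge0.
elim: n => [|n IHn]; first by rewrite /series /= big_nat1 mul1r.
rewrite -IHn /series /= [in LHS]big_nat_recr//=.
have := @telescope_normr_gbinom_half R n.+1 isT; rewrite -/(b _) -/(b _) => bn.
by move: (\sum_(_ <= _ < _) _) => S; lra.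
Qed.

(** The exponent 0, where 0^0 = 1, must be covered: it occurs as [u - 1] when [u = 1]. *)
Lemma powR_cvg_at_right0 (R : realType) (r : R) : 0 <= r ->
  t `^ r @[t --> 0^'+] --> (0 : R) `^ r.
Proof.
rewrite le_eqVlt => /predU1P[<-|r0].
  by under eq_cvg do rewrite powRr0; rewrite powRr0; exact: cvg_cst.
by rewrite powR0 ?gt_eqF//; exact: powR_cvg0.
Qed.

(** Serves integration by parts twice: with [r = u] for the primitive, and with [r = u - 1] for
    continuity of its derivative up to the endpoint 0. *)
Lemma derivable_oo_LRcontinuous_powR (R : realType) (r T : R) :
  0 <= r -> 0 < T -> derivable_oo_LRcontinuous (fun t => t `^ r) 0 T.
Proof.
move=> r0 T0; split.
- move=> x; rewrite in_itv/= => /andP[x0 _].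
  by apply: derivable_powR; rewrite in_itv/= x0.
- exact: powR_cvg_at_right0.
- have /differentiable_continuous/cvg_at_left_filter// :
      differentiable (fun t : R => t `^ r) T.
  by apply/derivable1_diffP; apply: derivable_powR; rewrite in_itv/= T0.
Qed.

Definition Gamma_integrand (R : realType) (s t : R) : R :=
  t `^ (s - 1) * expR (- t).

Lemma Gamma_integrand_ge0 (R : realType) (s t : R) : 0 <= Gamma_integrand s t.
Proof. by rewrite mulr_ge0 ?powR_ge0 ?expR_ge0. Qed.

Lemma measurable_Gamma_integrand (R : realType) (s : R) :
  measurable_fun setT (Gamma_integrand s).
Proof.
apply: measurable_funM; first exact: measurable_powR.
by apply: measurableT_comp.
Qed.

Lemma is_derive_opp_expRN (R : realType) (x : R) :
  is_derive x 1 (fun t : R => - expR (- t)) (expR (- x)).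
Proof.
apply: is_derive_eq; rewrite /=; ring.
Qed.

(** One half of the functional equation of Gamma, by parts on each [[0, T]] and a supremum over [T].
    It is stated in the extended reals, so that infinite integrals are allowed. *)
Lemma Gamma_integral_succ_le (R : realType) (u : R) : 1 <= u ->
  (\int[lebesgue_measure]_(t in `[0%R, +oo[) (Gamma_integrand (u + 1) t)%:E <=
   u%:E *
   \int[lebesgue_measure]_(t in `[0%R, +oo[) (Gamma_integrand u t)%:E)%E.
Proof.
move=> u1; have u0 : 0 < u by exact: lt_le_trans u1.
rewrite (ge0_integral_ereal_sup _ (Gamma_integrand_ge0 _)); last first.
  exact: measurable_Gamma_integrand.
apply: ge_ereal_sup => _ [k _ <-].
set T : R := k.+1%:R; have T0 : 0 < T by rewrite ltr0n.
have dG x : derivable (fun t : R => - expR (- t)) x 1.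
  by have [] := is_derive_opp_expRN x.
have cG : continuous (fun t : R => - expR (- t)).
  by move=> x; apply: differentiable_continuous; exact/derivable1_diffP.
have cpow : {within `[0, T], continuous (fun t => u * t `^ (u - 1))}.
  have := derivable_oo_LRcontinuous_within
    (@derivable_oo_LRcontinuous_powR R (u - 1) T _ T0).
  rewrite subr_ge0 => /(_ u1)/subspace_continuousP cp.
  apply/subspace_continuousP => x xT; apply: cvgM; first exact: cvg_cst.
  exact: cp.
have bp := @integration_by_parts R (fun t => t `^ u) (fun t => - expR (- t))
  (fun t => u * t `^ (u - 1)) (fun t => expR (- t)) 0 T T0 cpow.
rewrite [X in (X <= _)%E](_ : _ = \int[lebesgue_measure]_(x in `[0%R, T])
    (x `^ u * expR (- x))%:E)%E; last first.
  by apply: eq_integral => x _; rewrite /Gamma_integrand addrK.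
rewrite {}bp; first last.
- by move=> x _; rewrite derive1E; have [_ ->] := is_derive_opp_expRN x.
- by split => [x _| |]; [exact: dG|exact/cvg_at_right_filter/cG|
    exact/cvg_at_left_filter/cG].
- apply: continuous_subspaceT => x.
  by apply: continuous_comp; [exact: continuousN|exact: continuous_expR].
- move=> x; rewrite in_itv/= => /andP[x0 _].
  by apply: powR_derive1; rewrite in_itv/= x0.
- exact: derivable_oo_LRcontinuous_powR (ltW u0) T0.
rewrite powR0 ?gt_eqF// mul0r subr0.
(* The boundary term [- T^u * exp(- T)] is nonpositive and is dropped, so no limit at infinity is
   taken. *)
apply: (@le_trans _ _ (- \int[lebesgue_measure]_(x in `[0%R, T])
    (u * x `^ (u - 1) * - expR (- x))%:E)%E).
  by rewrite geeDr// lee_fin mulrN oppr_le0 mulr_ge0 ?powR_ge0 ?expR_ge0.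
under eq_integral do rewrite mulrN -mulrA EFinN EFinM.
have g0 x : (0 <= (Gamma_integrand u x)%:E)%E.
  by rewrite lee_fin Gamma_integrand_ge0.
have mg (D : set R) : measurable_fun D (EFin \o Gamma_integrand u).
  apply/measurable_EFinP; apply: measurable_funTS.
  exact: measurable_Gamma_integrand.
rewrite integral_ge0N; last first.
  by move=> x _; apply: mule_ge0; [rewrite lee_fin ltW|exact: g0].
rewrite oppeK ge0_integralZl_EFin//; last exact: ltW.
- rewrite lee_pmul2l// ge0_subset_integral//; first exact: mg.
  + by move=> x _; exact: g0.
  + exact: subset_itvl.
- by move=> x _; exact: g0.
- exact: mg.
Qed.

Lemma Gamma_ratio_le (R : realType) (u : R) : 1 <= u ->
  0 <= Gamma (u + 1) / Gamma u <= u.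
Proof.
move=> u1.
pose I s : \bar R := (\int[lebesgue_measure]_(t in `[0%R, +oo[)
  (Gamma_integrand (s : R) t)%:E)%E.
have GE s : Gamma s = fine (I s).
  rewrite /Gamma /Rintegral /I -[in RHS]integral_itv_obnd_cbnd//.
  apply/measurable_EFinP; apply: measurable_funTS.
  exact: measurable_Gamma_integrand.
have I0 s : (0 <= I s)%E.
  by apply: integral_ge0 => t _; rewrite lee_fin Gamma_integrand_ge0.
have u0 : 0 < u by exact: lt_le_trans u1.
rewrite divr_ge0 !GE ?fine_ge0//=.
have : (I (u + 1)%R <= u%:E * I u)%E by exact: Gamma_integral_succ_le.
move: (I0 (u + 1)) (I0 u).
(* If [I u] is infinite then [Gamma u = fine +oo = 0] and the quotient is [0]. *)
case: (I u) => [y|_ _ _|//] /=; last by rewrite invr0 mulr0 ltW.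
(* A finite [I u] forces [I (u + 1)] to be finite. If [I u = 0], the quotient is 0 by the convention
   on inverses. *)
rewrite -EFinM; case: (I (u + 1)) => [x _||] //=.
rewrite !lee_fin le_eqVlt => /predU1P[<- _|y0 xy].
  by rewrite invr0 mulr0 ltW.
by rewrite ler_pdivrMr.
Qed.

Definition Euler_integral (R : realType) (v u w c : R) : R :=
  \int[lebesgue_measure]_(xi in `]0%R, 1%R[)
     (xi `^ (u - 1) * (1 - xi) `^ (w - u - 1) * (1 - c * xi) `^ (- v)).

(** On the unit interval every factor is at most 1: the middle exponent vanishes, [u - 1 >= 0] acts
    on a base below 1, and [- v <= 0] on the base [1 + xi >= 1]. *)
Lemma Euler_integral_succ_le1 (R : realType) (v u : R) : 0 <= v -> 1 <= u ->
  0 <= Euler_integral v u (u + 1) (- 1) <= 1.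
Proof.
move=> v0 u1; set f := fun xi : R =>
  xi `^ (u - 1) * (1 - xi) `^ (u + 1 - u - 1) * (1 - -1 * xi) `^ (- v).
have f0 x : 0 <= f x by rewrite !mulr_ge0 ?powR_ge0.
have If0 : (0 <= \int[lebesgue_measure]_(x in `]0%R, 1%R[) (f x)%:E)%E.
  by apply: integral_ge0 => x _; rewrite lee_fin.
rewrite /Euler_integral /Rintegral fine_ge0//=.
(* The extended-real bound also yields the finiteness that [fineK] requires. *)
suff If1 : (\int[lebesgue_measure]_(x in `]0%R, 1%R[) (f x)%:E <= 1)%E.
  rewrite -lee_fin fineK// fin_real// (lt_le_trans _ If0)//.
  by rewrite (le_lt_trans If1) ?ltry.
apply: (@le_trans _ _ (\int[lebesgue_measure]_(x in `]0%R, 1%R[) 1)%E).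
  apply: ge0_le_integral => //.
  - by move=> x _; rewrite lee_fin.
  - apply/measurable_EFinP/measurable_funTS.
    apply: measurable_funM; first apply: measurable_funM => //.
      apply: (@measurableT_comp _ _ _ _ _ _ (@powR R ^~ _)) => //.
      exact: measurable_funB.
    apply: (@measurableT_comp _ _ _ _ _ _ (@powR R ^~ _)) => //.
    by apply: measurable_funB => //; exact: measurable_funM.
  - move=> x /=; rewrite in_itv/= => /andP[x0 x1]; rewrite lee_fin /f.
    have -> : u + 1 - u - 1 = 0 by ring.
    rewrite powRr0 mulr1 -[leRHS]mulr1 ler_pM ?powR_ge0//.
      by rewrite -[leRHS](powRr0 x) ger_powR ?x0 ?(ltW x1) ?subr_ge0.
    rewrite -[leRHS](powRr0 (1 - -1 * x)) ler_powR ?oppr_le0//; lra.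
have mu01 := @lebesgue_measure_itv R `]0, 1[.
rewrite /= lte01 oppr0 adde0 in mu01.
by rewrite integral_cst// mul1e [leLHS]mu01.
Qed.

(** The comparison needs a bound uniform in [u], so [Gamma 1] stays as an unevaluated constant. *)
Lemma hyp2F1_succ_le (R : realType) (v u : R) : 0 <= v -> 1 <= u ->
  `|u^-1 * hyp2F1 v u (u + 1) (- 1)| <= (Gamma (1 : R))^-1.
Proof.
move=> v0 u1; have u0 : 0 < u by exact: lt_le_trans u1.
have /andP[G0 Gu] := Gamma_ratio_le u1.
have /andP[E0 E1] := Euler_integral_succ_le1 v0 u1.
have G1 : 0 <= (Gamma (1 : R))^-1.
  by rewrite invr_ge0 Rintegral_ge0// => t _; exact: Gamma_integrand_ge0.
rewrite /hyp2F1 -/(Euler_integral v u (u + 1) (- 1)).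
have -> : u + 1 - u = 1 by ring.
rewrite invfM mulrA -mulrA.
set e := Euler_integral _ _ _ _ in E0 E1 *.
have -> : u^-1 * (Gamma (u + 1) * ((Gamma u)^-1 / Gamma 1) * e) =
  (Gamma (u + 1) / Gamma u / u * e) / Gamma (1 : R) by ring.
have q0 : 0 <= Gamma (u + 1) / Gamma u / u by rewrite divr_ge0 ?(ltW u0).
rewrite ger0_norm; last by apply: mulr_ge0 => //; exact: mulr_ge0.
rewrite ler_piMl// mulr_ile1//.
by rewrite ler_pdivrMr// mul1r.
Qed.

Lemma u_ge1_of_gt0 (R : realType) (n : R) (m : nat) :
  0 < n -> (0 < m)%N -> 1 <= u_ n m.
Proof.
move=> n0 m0; have m1 : 1 <= m%:R :> R by rewrite ler1n.
rewrite /u_; case: ifPn => [n1|]; last rewrite -ltNge => n1.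
  by rewrite lerDl divr_ge0 ?(ltW n0)// !mulr_ge0 ?subr_ge0.
(* Since [m >= 1] and [n > 1], [1 + 2m(n - 1) >= 2n - 1 >= n]. *)
rewrite ler_pdivlMr//; nra.
Qed.

Theorem proposition3p2 (R : realType) (a n : R) (a_gt0 : 0 < a) (n_gt0 : 0 < n) :
  cvgn [normed series (series_term a n)].
Proof.
have c0 : 0 <= 8 * a / n by rewrite divr_ge0 ?mulr_ge0 ?ltW.
have G0 : 0 <= (Gamma (1 : R))^-1.
  by rewrite invr_ge0 Rintegral_ge0// => t _; exact: Gamma_integrand_ge0.
(* [gbinom (1 / 2) 0 = 1], so the second summand of [C] absorbs the term of
   index [0], for which [u_ n 0] may be less than [1]. *)
pose C := 8 * a / n / Gamma 1 + `|series_term a n 0|.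
have C0 : 0 <= C by apply: addr_ge0 => //; exact: mulr_ge0.
apply: (@series_le_cvg _ _ (fun m => C * `|gbinom (1 / 2) m|)) =>
  [m /=|m|m /=|].
- exact: normr_ge0.
- exact: mulr_ge0.
- have [->|m0] := posnP m.
    rewrite /gbinom big_ord0 divr1 normr1 mulr1.
    by rewrite /C lerDr; exact: mulr_ge0.
  (* For [m >= 1] the first summand of [C] suffices, by [hyp2F1_succ_le] with [v = 1 + 1 / n]. *)
  apply: (@le_trans _ _ (8 * a / n / Gamma 1 * `|gbinom (1 / 2) m|)).
    rewrite /series_term normrM (ger0_norm c0) -[leRHS]mulrA ler_wpM2l//.
    rewrite mulrAC normrM ler_wpM2r// hyp2F1_succ_le ?u_ge1_of_gt0//.
    by rewrite addr_ge0 ?divr_ge0 ?ltW.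
  by rewrite ler_wpM2r// lerDl.
exact: (@is_cvg_seriesZ _ _ C (@cvg_series_normr_gbinom_half R)).
Qed.
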